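(* Let $s\ge 2$. Let $(\vec u,\vec t,\vec v)$ be coordinates on $\mathbb{R}^{3s}$, where $\vec u=(u_1,\dots,u_s)$, $\vec t=(t_1,\dots,t_s)$, $\vec v=(v_1,\dots,v_s)$. Let $M_{3s}:=\mathbb{R}^{3s}$ with the pseudo-Riemannian metric $g_{3s}$ of signature $(2s,s)$ given by $$g_{3s}(\partial_i^u,\partial_j^u)=-2\delta_{ij}\sum_{1\le k\le s}u_kt_k,\quad g_{3s}(\partial_i^u,\partial_j^v)=g_{3s}(\partial_j^v,\partial_i^u)=\delta_{ij},\quad g_{3s}(\partial_i^t,\partial_j^t)=-\delta_{ij},$$ $$g_{3s}(\partial_i^u,\partial_j^t)=g_{3s}(\partial_j^t,\partial_i^u)=0,\quad g_{3s}(\partial_i^t,\partial_j^v)=g_{3s}(\partial_j^v,\partial_i^t)=0,\quad g_{3s}(\partial_i^v,\partial_j^v)=0.$$ Then the manifold $(M_{3s},g_{3s})$ is: (1) spacelike rank $4$ Jordan Ivanov-Petrova; (2) not timelike Jordan Ivanov-Petrova; (3) $k$-spacelike Jordan Stanilov for $2\le k\le s$; (4) for $2\le k\le 2s$, $k$-timelike Jordan Stanilov if and only if $k=2s$.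
   Context: Signature $(p,q)$ means $p$ timelike (negative) and $q$ spacelike (positive) directions. Let $(M,g)$ be a pseudo-Riemannian manifold with Riemann curvature tensor $R$ of the Levi-Civita connection and curvature operator $R(x,y)$ determined by $R(x,y,z,w)=g(R(x,y)z,w)$. A linear subspace of $T_PM$ is spacelike (resp. timelike) if the restriction of $g_P$ to it is positive (resp. negative) definite. For an oriented spacelike or timelike $2$-plane $\pi\subset T_PM$ with oriented orthonormal basis $\{e_1,e_2\}$, the skew-symmetric curvature operator is $\mathcal{R}(\pi):=R(e_1,e_2)$ (independent of the basis). $(M,g)$ is spacelike (resp. timelike) Jordan Ivanov-Petrova if for every $P\in M$ the Jordan normal form (conjugacy class) of $\mathcal{R}(\pi)$ is the same for all oriented spacelike (resp. timelike) $2$-planes $\pi\subset T_PM$. It is spacelike rank $r$ Jordan Ivanov-Petrova if in addition $\operatorname{Rank}\{\mathcal{R}(\pi)\}=r$ for every oriented spacelike $2$-plane $\pi$ at every point. For an unoriented spacelike or timelike $k$-plane $\pi\subset T_PM$ with orthonormal basis $\{e_1,\dots,e_k\}$, the higher order curvature operator is $\Theta(\pi):=\sum_{i,j}R(e_i,e_j)R(e_i,e_j)$ (independent of the basis). $(M,g)$ is $k$-spacelike (resp. $k$-timelike) Jordan Stanilov if for every $P\in M$ the Jordan normal form of $\Theta(\pi)$ is the same for all spacelike (resp. timelike) $k$-planes $\pi\subset T_PM$. In all cases the Jordan normal form is allowed to vary with $P$. Here $\partial_i^u=\partial/\partial u_i$, $\partial_i^t=\partial/\partial t_i$, $\partial_i^v=\partial/\partial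 v_i$. *)

(* Defs.v *)
From HB Require Import structures.
From mathcomp Require Import all_boot all_order all_algebra.
From mathcomp Require Import all_classical all_reals all_analysis.
From mathcomp Require Import ring.
Set Implicit Arguments.
Unset Strict Implicit.
Unset Printing Implicit Defensive.
Import Order.TTheory GRing.Theory Num.Theory.
Import numFieldNormedType.Exports.
Local Open Scope ring_scope.

Section PseudoRiemannian.
Variables (R : realType) (n : nat).
Implicit Types (g : 'rV[R]_n -> 'M[R]_n) (x a b : 'rV[R]_n).
Implicit Types (U V W : {vspace 'rV[R]_n}).

Definition partial (i : 'I_n) (f : 'rV[R]_n -> R) : 'rV[R]_n -> R :=
  fun x => 'D_(delta_mx 0 i) f x.

Fixpoint is_Ck (k : nat) (f : 'rV[R]_n -> R) : Prop :=
  if k is k'.+1 then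
    forall i, (forall x, derivable f x (delta_mx 0 i)) /\ is_Ck k' (partial i f)
  else continuous f.

Definition smooth (f : 'rV[R]_n -> R) : Prop := forall k, is_Ck k f.

(* A tensor field g on the manifold R^n is given by its matrix of components
   in the global coordinate frame; every tangent space is 'rV_n. *)
Definition gdot g x a b : R := (a *m g x *m b^T) 0 0.

Definition spacelike g x W : Prop :=
  forall a, a \in W -> a != 0 -> 0 < gdot g x a a.

Definition timelike g x W : Prop :=
  forall a, a \in W -> a != 0 -> gdot g x a a < 0.

Definition has_signature (p q : nat) g x : Prop :=
  exists U V, [/\ (U + V)%VS = fullv, \dim U = p /\ \dim V = q,
    timelike g x U, spacelike g x V &
    forall a b, a \in U -> b \in V -> gdot g x a b = 0].

Definition pseudo_riemannian (p q : nat) g : Prop :=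
  [/\ p + q = n,
      forall i j, smooth (fun x => g x i j),
      forall x, (g x)^T = g x &
      forall x, has_signature p q g x]%N.

(* Levi-Civita connection: nabla_{d_i} d_j = \sum_k (christoffel g k i j) d_k *)
Definition christoffel g (k i j : 'I_n) : 'rV[R]_n -> R :=
  fun x => 2^-1 * \sum_l invmx (g x) k l *
    (partial i (fun y => g y j l) x + partial j (fun y => g y i l) x
     - partial l (fun y => g y i j) x).

Definition torsion_free (G : 'I_n -> 'I_n -> 'I_n -> 'rV[R]_n -> R) : Prop :=
  forall k i j x, G k i j x = G k j i x.

Definition metric_compatible g (G : 'I_n -> 'I_n -> 'I_n -> 'rV[R]_n -> R) :=
  forall l i j x, partial l (fun y => g y i j) x =
    \sum_m G m l i x * g x m j + \sum_m G m l j x * g x i m.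

Lemma levi_civitaP g (G : 'I_n -> 'I_n -> 'I_n -> 'rV[R]_n -> R) :
    (forall x, g x \in unitmx) -> (forall x, (g x)^T = g x) ->
  torsion_free G /\ metric_compatible g G <->
  forall k i j x, G k i j x = christoffel g k i j x.
Proof.
move=> gU gT.
have gS x i j : g x i j = g x j i by rewrite -{1}gT mxE.
have gSf i j : (fun y => g y i j) = (fun y => g y j i) by apply/funext => y.
have invS x i j : invmx (g x) i j = invmx (g x) j i.
  by rewrite -{1}gT -trmx_inv mxE.
pose S x (i j l : 'I_n) := partial i (fun y => g y j l) x
  + partial j (fun y => g y i l) x - partial l (fun y => g y i j) x.
have low x i j l : \sum_m christoffel g m i j x * g x m l = 2^-1 * S x i j l.
  transitivity (\sum_m \sum_p
      2^-1 * S x i j p * (invmx (g x) p m * g x m l)).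
    apply: eq_bigr => m _; rewrite /christoffel mulr_sumr mulr_suml.
    by apply: eq_bigr => p _; rewrite invS /S; ring.
  rewrite exchange_big (bigD1 l) //= [X in _ + X]big1 ?addr0.
    have /matrixP/(_ l l) := mulVmx (gU x); rewrite !mxE eqxx => e.
    by rewrite -mulr_sumr e mulr1.
  move=> p /negPf pl; have /matrixP/(_ p l) := mulVmx (gU x).
  by rewrite !mxE pl => e; rewrite -mulr_sumr e mulr0.
split=> [[tf mc] k i j x|GE].
  have lowG l : \sum_m G m i j x * g x m l = 2^-1 * S x i j l.
    rewrite /S !mc.
    have E1 (a b c : 'I_n) : \sum_m G m a b x * g x c m = \sum_m G m a b x * g x m c.
      by apply: eq_bigr => m _; rewrite (gS x c).
    have E2 (a b c : 'I_n) : \sum_m G m a b x * g x m c = \sum_m G m b a x * g x m c.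
      by apply: eq_bigr => m _; rewrite tf.
    by rewrite !E1 (E2 j i l) (E2 l i j) (E2 l j i); field.
  have e : (\row_m G m i j x) *m g x = (\row_m christoffel g m i j x) *m g x.
    apply/rowP => l; rewrite !mxE.
    under eq_bigr do rewrite mxE.
    under [RHS]eq_bigr do rewrite mxE.
    by rewrite lowG low.
  have /rowP/(_ k) := congr1 (mulmx^~ (invmx (g x))) e.
  by rewrite !mulmxK // !mxE.
split=> [k i j x|l i j x].
  rewrite !GE /christoffel; congr (_ * _); apply: eq_bigr => l _.
  by rewrite (gSf i j) [X in X - _]addrC.
have -> : \sum_m G m l i x * g x m j = 2^-1 * S x l i j.
  by rewrite -low; apply: eq_bigr => m _; rewrite GE.
have -> : \sum_m G m l j x * g x i m = 2^-1 * S x l j i.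
  by rewrite -low; apply: eq_bigr => m _; rewrite GE gS.
by rewrite /S (gSf j i); field.
Qed.

(* R(d_i, d_j) d_k = \sum_l (riemann g i j k l) d_l, with
   R(X, Y) = nabla_X nabla_Y - nabla_Y nabla_X - nabla_[X, Y] *)
Definition riemann g (i j k l : 'I_n) : 'rV[R]_n -> R :=
  fun x => partial i (christoffel g l j k) x - partial j (christoffel g l i k) x
    + \sum_m (christoffel g m j k x * christoffel g l i m x
              - christoffel g m i k x * christoffel g l j m x).

(* Matrix of the endomorphism R(a, b) of the tangent space at x, acting on row
   vectors on the right: R(a, b) c = c *m curvature_op g x a b. *)
Definition curvature_op g x a b : 'M[R]_n :=
  \matrix_(k, l) \sum_i \sum_j a 0 i * b 0 j * riemann g i j k l x.

(* For a definite subspace W the absolute value amounts to g(e_i, e_j) being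
   the Kronecker delta up to the sign of g on W. *)
Definition orthonormal_basis g x W (k : nat) (e : k.-tuple 'rV[R]_n) : Prop :=
  basis_of W e /\
  forall i j, `|gdot g x (tnth e i) (tnth e j)| = (i == j)%:R.

Definition skew_curvature_op g x (e : 2.-tuple 'rV[R]_n) : 'M[R]_n :=
  curvature_op g x (tnth e 0) (tnth e 1).

Definition stanilov_op g x (k : nat) (e : k.-tuple 'rV[R]_n) : 'M[R]_n :=
  \sum_i \sum_j curvature_op g x (tnth e i) (tnth e j) *m
                curvature_op g x (tnth e i) (tnth e j).

Definition same_jordan_form (A B : 'M[R]_n) : Prop := A ~_{in unitmx} B.

(* Causal characters (spacelike or timelike) of subspaces of tangent spaces. *)
Implicit Types (D : ('rV[R]_n -> 'M[R]_n) -> 'rV[R]_n ->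
                    {vspace 'rV[R]_n} -> Prop).

(* An ordered orthonormal basis of a 2-plane W orients W, and each orientation
   of W is obtained this way; so quantifying over the 2-planes W and over all
   ordered orthonormal bases of W is quantifying over oriented 2-planes
   equipped with an oriented orthonormal basis. *)
Definition jordan_ivanov_petrova D g : Prop :=
  forall x W W' (e e' : 2.-tuple 'rV[R]_n),
    D g x W -> D g x W' ->
    orthonormal_basis g x W e -> orthonormal_basis g x W' e' ->
    same_jordan_form (skew_curvature_op g x e) (skew_curvature_op g x e').

Definition spacelike_rank_jordan_ivanov_petrova (r : nat) g : Prop :=
  jordan_ivanov_petrova spacelike g /\
  forall x W (e : 2.-tuple 'rV[R]_n),
    spacelike g x W -> orthonormal_basis g x W e ->
    \rank (skew_curvature_op g x e) = r.

Definition jordan_stanilov D (k : nat) g : Prop :=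
  forall x W W' (e e' : k.-tuple 'rV[R]_n),
    D g x W -> D g x W' ->
    orthonormal_basis g x W e -> orthonormal_basis g x W' e' ->
    same_jordan_form (stanilov_op g x e) (stanilov_op g x e').

End PseudoRiemannian.

(* Coordinates (u, t, v) on R^(3s): the row vector row_mx (row_mx u t) v. *)
Definition g3s (R : realType) (s : nat) (x : 'rV[R]_(s + s + s)) :
    'M[R]_(s + s + s) :=
  let u : 'rV[R]_s := lsubmx (lsubmx x) in
  let t : 'rV[R]_s := rsubmx (lsubmx x) in
  block_mx
    (block_mx (- 2 * \sum_(k < s) u 0 k * t 0 k)%:M 0
              0                                     (- 1)%:M)
    (col_mx 1%:M 0)
    (row_mx 1%:M 0) 0.

(* Main.v *)
Require Import Defs.
From mathcomp Require Import all_boot all_order all_algebra.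
From mathcomp Require Import all_classical all_reals all_analysis.
From mathcomp Require Import ring zify.
Set Implicit Arguments.
Unset Strict Implicit.
Unset Printing Implicit Defensive.
Import Order.TTheory GRing.Theory Num.Theory.
Import numFieldNormedType.Exports.
Local Open Scope ring_scope.

(** Tangent vectors are row vectors (u, t, v).  Write [g = phi N + H] with [N] and
    [H] constant matrices and [phi = - 2 \sum_k u_k t_k].  Because the
    differential of [phi] is linear in the coordinates, the Christoffel symbols
    are linear in the point, almost all products of two of them vanish, and the
    curvature operator is strictly block upper triangular:
      [R(a, b) = (0, K, L; 0, 0, - K; 0, 0, 0)],
    where, with [al] and [be] the u-components of [a] and [b],
    [K = al^T be - be^T al] and [L] maps [al^\perp \cap be^\perp] into the span
    of [al] and [be] ([curvature_op_nil]).  Hence everything is governed by the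
    matrix [A] of the u-components of an orthonormal frame.

    - A frame of a spacelike [k]-plane has [A] of rank [k], because [g] is
      nonpositive on vectors whose u-component is zero.  A frame of a timelike
      [k]-plane has [A] of rank at least [k - s], because such vectors are null
      as soon as their t-component vanishes too; and every rank [p] such that
      [p <= minn k s] and [k - p <= s] occurs.

    - If [A] has rank 2, [R(e_1, e_2)] is conjugate to a fixed matrix of rank 4:
      block upper triangular conjugations kill [L] and put [K] in normal form
      ([nil_block_similar]).  If [A = 0], then [R(e_1, e_2) = 0].  This settles
      the Ivanov-Petrova part, as both cases occur on timelike 2-planes.

    - [R(e_i, e_j)^2] has the single nonzero block [- K^2], in the corner, so the
      Stanilov operator is determined up to conjugacy by the rank of its corner
      block ([corner_similar]).  With [G = A^T A] this block is
      [2 (\tr G - G) G] ([sum_wedge_sqr]).  If [A] has rank at least 2, then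
      [\tr G - G] is invertible by the equality case of the Cauchy-Schwarz
      inequality ([unitmx_trace_gram]), so the rank of the block is that of [A].
      On spacelike [k]-planes this rank is [k].  On timelike [2s]-planes it is
      [s]; for [k < 2s], timelike frames with u-rank [minn k s] and
      [k - minn k s] have Stanilov operators of different ranks. *)

(** * Gram matrices over an ordered field *)

Section RealMatrices.
Variable F : realFieldType.

Lemma mxtrace_gram m n (A : 'M[F]_(m, n)) :
  \tr (A *m A^T) = \sum_i \sum_j A i j ^+ 2.
Proof.
apply: eq_bigr => i _; rewrite mxE; apply: eq_bigr => j _.
by rewrite mxE expr2.
Qed.

Lemma mxtrace_gram_eq0 m n (A : 'M[F]_(m, n)) : \tr (A *m A^T) = 0 -> A = 0.
Proof.
have sq0 i : 0 <= \sum_j A i j ^+ 2 by apply: sumr_ge0 => j _; apply: sqr_ge0.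
rewrite mxtrace_gram => /eqP; rewrite psumr_eq0 // => /allP z.
apply/matrixP => i j; have := z i (mem_index_enum _).
rewrite /= psumr_eq0 => [/allP /(_ j (mem_index_enum _))|k _]; last exact: sqr_ge0.
by rewrite mxE /= sqrf_eq0 => /eqP.
Qed.

Lemma dotmx_ge0 n (a : 'rV[F]_n) : 0 <= (a *m a^T) 0 0.
Proof. by rewrite mxE; apply: sumr_ge0 => i _; rewrite mxE -expr2 sqr_ge0. Qed.

Lemma dotmx_eq0 n (a : 'rV[F]_n) : (a *m a^T) 0 0 = 0 -> a = 0.
Proof. by rewrite -trace_mx11; apply: mxtrace_gram_eq0. Qed.

Lemma mxrank_gram m n (A : 'M[F]_(m, n)) : \rank (A *m A^T) = \rank A.
Proof.
apply/eqP; rewrite eqn_leq mxrankM_maxl /=.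
suff : (kermx (A *m A^T) <= kermx A)%MS.
  move/mxrankS; rewrite !mxrank_ker => le.
  have := rank_leq_row A; have := rank_leq_row (A *m A^T); lia.
apply/sub_kermxP/mxtrace_gram_eq0.
by rewrite trmx_mul mulmxA -(mulmxA _ A) mulmx_ker mul0mx raddf0.
Qed.

Lemma row_free_gram m n (A : 'M[F]_(m, n)) :
  row_free A -> A *m A^T \in unitmx.
Proof. by rewrite -row_free_unit /row_free mxrank_gram. Qed.

(** Equality case of the Cauchy-Schwarz inequality: with [G = A^T *m A], the
    vector [z] is in the kernel of [\tr G - G] only if the inequalities between
    [z] and the rows of [A] are all equalities, so that these rows are
    multiples of [z]. *)
Lemma unitmx_trace_gram m n (A : 'M[F]_(m, n)) : (1 < \rank A)%N ->
  (\tr (A^T *m A))%:M - A^T *m A \in unitmx.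
Proof.
move=> rA; set G := A^T *m A; set c := \tr G.
rewrite -row_free_unit; apply: inj_row_free => z /eqP.
rewrite mulmxBr mul_mx_scalar subr_eq0 => /eqP zG; apply/eqP.
apply: contraTT rA => z0; rewrite -leqNgt.
set d := (z *m z^T) 0 0.
have zz : z *m z^T = d%:M by rewrite [LHS]mx11_scalar.
have d0 : d != 0 by apply: contraNneq z0 => /dotmx_eq0 ->.
set b := A *m z^T.
have bT : b^T = z *m A^T by rewrite trmx_mul trmxK.
(* The rows of [d *: A - b *m z] are [d] times the components of the rows of [A]
   orthogonal to [z]. *)
have eB : d *: A - b *m z = 0.
  apply: mxtrace_gram_eq0.
  have -> : (d *: A - b *m z) *m (d *: A - b *m z)^T =
            d *: (d *: (A *m A^T) - b *m b^T).
    rewrite [(_ - _)^T]linearB /= [(d *: A)^T]linearZ /= trmx_mul.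
    rewrite mulmxBl !mulmxBr -!scalemxAl -!scalemxAr.
    rewrite [A *m (_ *m _)]mulmxA -/b -[b *m z *m A^T]mulmxA -bT.
    rewrite -[b *m z *m _]mulmxA (mulmxA z) zz.
    by rewrite mul_scalar_mx -scalemxAr scalerBr opprB subrr addr0.
  rewrite linearZ linearB linearZ /= (mxtrace_mulC A) -/G -/c.
  have -> : \tr (b *m b^T) = c * d.
    rewrite mxtrace_mulC bT /b !mulmxA -(mulmxA z) -/G -zG.
    by rewrite -scalemxAl linearZ /= trace_mx11.
  by rewrite (mulrC c) subrr mulr0.
have -> : A = (d^-1 *: b) *m z.
  move/eqP: eB; rewrite subr_eq0 -scalemxAl => /eqP <-.
  by rewrite scalerA mulVf ?scale1r.
by apply: leq_trans (mxrankM_maxl _ _) (rank_leq_col _).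
Qed.

(** Matrices of the same rank are equivalent. *)
Lemma unit_equiv_rank n (S T : 'M[F]_n) : \rank S = \rank T ->
  exists P Q, [/\ P \in unitmx, Q \in unitmx & P *m S = T *m Q].
Proof.
move=> rST; exists (col_ebase T *m invmx (col_ebase S)).
exists (invmx (row_ebase T) *m row_ebase S).
rewrite !unitmx_mul !unitmx_inv !col_ebase_unit !row_ebase_unit; split=> //.
rewrite -{2}(mulmx_ebase S) -{2}(mulmx_ebase T) rST !mulmxA.
by rewrite mulmxKV ?col_ebase_unit // mulmxK ?row_ebase_unit.
Qed.

Lemma orthogonal_complement m n (A : 'M[F]_(m, m + n)) : row_free A ->
  exists2 C : 'M[F]_(n, m + n), row_free C & C *m A^T = 0.
Proof.
move=> /eqP rA.
have : \rank (kermx A^T) = n by rewrite mxrank_ker mxrank_tr rA addKn.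
move: (kermx A^T) (mulmx_ker A^T) => K K0 rK.
exists (castmx (rK, erefl) (row_base K)).
  by rewrite row_free_castmx row_base_free.
apply/sub_kermxP; rewrite eqmx_cast eq_row_base; exact/sub_kermxP.
Qed.

(** The skew-symmetric matrix of [c |-> (c . a) b - (c . b) a]. *)
Definition wedge n (a b : 'rV[F]_n) : 'M[F]_n := a^T *m b - b^T *m a.

(** The sum runs over all pairs of rows, as in the definition of the Stanilov
    operator; the factor 2 comes from the two orders of each pair. *)
Lemma sum_wedge_sqr k n (A : 'M[F]_(k, n)) :
  \sum_i \sum_j wedge (row i A) (row j A) *m wedge (row i A) (row j A) =
  - 2 *: (((\tr (A^T *m A))%:M - A^T *m A) *m (A^T *m A)).
Proof.
set G := A^T *m A.
have GE : G = \sum_i (row i A)^T *m row i A.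
  apply/matrixP => p q; rewrite !mxE summxE; apply: eq_bigr => i _.
  by rewrite !mxE big_ord1 !mxE.
have trG : \tr G = \sum_i (row i A *m (row i A)^T) 0 0.
  by rewrite GE raddf_sum; apply: eq_bigr => i _; rewrite /= mxtrace_mulC trace_mx11.
transitivity (\sum_i \sum_j
   ((((row i A)^T *m row i A) *m ((row j A)^T *m row j A)
    + ((row j A)^T *m row j A) *m ((row i A)^T *m row i A))
   - ((row j A *m (row j A)^T) 0 0 *: ((row i A)^T *m row i A)
    + (row i A *m (row i A)^T) 0 0 *: ((row j A)^T *m row j A)))).
  apply: eq_bigr => i _; apply: eq_bigr => j _.
  move: (row i A) (row j A) => {i j} a b; rewrite /wedge.
  have ab : b *m a^T = a *m b^T.
    by rewrite -[LHS]trmxK trmx_mul trmxK [a *m _]mx11_scalar tr_scalar_mx.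
  have e1 (c d : 'rV[F]_n) : d *m c^T = c *m d^T ->
      (c^T *m d) *m (c^T *m d) = (c^T *m c) *m (d^T *m d).
    by move=> cd; rewrite !mulmxA -(mulmxA _ d) cd !mulmxA.
  have e2 (c d : 'rV[F]_n) :
      (c^T *m d) *m (d^T *m c) = (d *m d^T) 0 0 *: (c^T *m c).
    rewrite mulmxA -(mulmxA _ d); move: (d *m d^T) => e.
    rewrite {1}[e]mx11_scalar mul_mx_scalar.
    by rewrite -scalemxAl.
  rewrite mulmxBl !mulmxBr !e2 (e1 _ _ ab) (e1 _ _ (esym ab)).
  rewrite !opprB addrACA [- _ - _]addrC -!addrA; congr (_ + _).
  by rewrite addrCA addrC -!addrA opprD addrCA.
under eq_bigr do rewrite sumrB !big_split /= -mulmx_sumr -mulmx_suml -GE.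
rewrite sumrB !big_split /= -!mulmx_suml -!mulmx_sumr -!GE.
under [X in - (X + _)]eq_bigr do rewrite -scaler_suml -trG.
under [X in - (_ + X)]eq_bigr do rewrite -scaler_sumr -GE.
rewrite -scaler_sumr -GE -scaler_suml -trG.
by rewrite mulmxBl mul_scalar_mx -!mulr2n -mulrnBl scaleNr scaler_nat -mulNrn opprB.
Qed.

End RealMatrices.

(** * Conjugacy classes of strictly block upper triangular matrices *)

Section Blocks.
Variable F : realFieldType.

(** The general shape of a curvature operator: the row vector (u, t, v) is sent
    to (0, u K, u L - t K). *)
Definition nil_block s (K L : 'M[F]_s) : 'M[F]_(s + s + s) :=
  block_mx (block_mx 0 K 0 0) (col_mx L (- K)) 0 0.

(** The general shape of a Stanilov operator: (u, t, v) is sent to (0, 0, u S). *)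
Definition corner s (S : 'M[F]_s) : 'M[F]_(s + s + s) :=
  block_mx 0 (col_mx S 0) 0 0.

(** The conjugating matrices: block upper triangular, with a zero corner. *)
Definition upper_block s (P1 P2 P3 Y Z : 'M[F]_s) : 'M[F]_(s + s + s) :=
  block_mx (block_mx P1 Y 0 P2) (col_mx 0 Z) 0 P3.

Lemma upper_block_unit s (P1 P2 P3 Y Z : 'M[F]_s) :
  P1 \in unitmx -> P2 \in unitmx -> P3 \in unitmx ->
  upper_block P1 P2 P3 Y Z \in unitmx.
Proof.
by rewrite !unitmxE !unitfE !det_ublock !mulf_eq0 !negb_or => -> -> ->.
Qed.

Lemma nil_block_sqr s (K L : 'M[F]_s) :
  nil_block K L *m nil_block K L = corner (- (K *m K)).
Proof.
rewrite /nil_block /corner !mulmx_block mul_block_col.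
by rewrite !(mulmx0, mul0mx, addr0, add0r) mulmxN ?block_mx0.
Qed.

Lemma corner_sum s I r (P : pred I) (S : I -> 'M[F]_s) :
  \sum_(i <- r | P i) corner (S i) = corner (\sum_(i <- r | P i) S i).
Proof.
elim/big_rec2: _ => [|i A B _ ->]; first by rewrite /corner col_mx0 block_mx0.
by rewrite /corner add_block_mx add_col_mx !addr0.
Qed.

Lemma corner_mxrank s (S : 'M[F]_s) : \rank (corner S) = \rank S.
Proof.
apply/eqP; rewrite eqn_leq; apply/andP; split.
  have -> : corner S = col_mx (col_mx 1%:M 0) 0 *m S *m row_mx 0 1%:M.
    rewrite /corner !mul_col_mx mul1mx !mul0mx mul_mx_row mulmx1.
    rewrite mulmx0 block_mxEv row_mx0; congr (col_mx _ _).
    by rewrite -[X in _ = col_mx _ X]row_mx0 -block_mxEv block_mxEh col_mx0.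
  apply: leq_trans (mxrankM_maxl _ _) (mxrankM_maxr _ _).
have {1}-> : S = row_mx (row_mx 1%:M 0) 0 *m corner S *m col_mx 0 1%:M.
  rewrite /corner mul_row_block !mul_row_col.
  by rewrite !(mulmx0, mul0mx, addr0, add0r, mul1mx, mulmx1).
apply: leq_trans (mxrankM_maxl _ _) (mxrankM_maxr _ _).
Qed.

Lemma corner_similar s (S T : 'M[F]_s) : \rank S = \rank T ->
  corner S ~_{in unitmx} corner T.
Proof.
move=> /unit_equiv_rank[P [Q [Pu Qu PQ]]].
have U := @upper_block_unit s P 1%:M Q 0 0 Pu (unitmx1 _ _) Qu.
exists (upper_block P 1%:M Q 0 0) => //; apply/(simmxP U).
rewrite /corner /upper_block !mulmx_block mul_block_col mul_col_mx.
by rewrite !(mulmx0, mul0mx, addr0, add0r) PQ !mul_col_mx ?mul0mx ?col_mx0.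
Qed.

Lemma similar_rank n (A B : 'M[F]_n) : A ~_{in unitmx} B -> \rank A = \rank B.
Proof.
case=> P Pu /(simmxP Pu) PA.
rewrite -[RHS](mxrankMfree _ (B := P)) ?row_free_unit // -PA.
by rewrite eqmxMfull // row_full_unit.
Qed.

(** Two matrices similar to the same matrix are similar. *)
Lemma similar_common n (A B C : 'M[F]_n) :
  A ~_{in unitmx} C -> B ~_{in unitmx} C -> A ~_{in unitmx} B.
Proof.
case=> P Pu /(simmxP Pu) PA [Q Qu /(simmxP Qu) QB].
have U : invmx Q *m P \in unitmx by rewrite unitmx_mul unitmx_inv Qu.
exists (invmx Q *m P) => //; apply/(simmxP U).
rewrite -mulmxA PA !mulmxA; congr (_ *m P).
by rewrite -[B in RHS](mulKmx Qu) QB !mulmxA mulmxK.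
Qed.

(** The generator of the rotations of the plane; for a matrix [A] with two rows
    [a] and [b], [A^T *m rot2 *m A] is [wedge a b]. *)
Definition rot2 : 'M[F]_2 := \matrix_(i, j) ((i < j)%N%:R - (j < i)%N%:R).

Lemma rot2_sqr : rot2 *m rot2 = - 1%:M.
Proof.
apply/matrixP => i j; rewrite !mxE !big_ord_recl big_ord0 !mxE.
case: i => [[|[]]] //= ?; case: j => [[|[]]] //= ?; rewrite -?val_eqE /=; ring.
Qed.

Lemma rot2_unit : rot2 \in unitmx.
Proof.
have /mulmx1_unit[]// : rot2 *m (- rot2) = 1%:M.
by rewrite mulmxN rot2_sqr opprK.
Qed.

(** The common normal form of the curvature operators of all the planes whose
    projection to the u-coordinates is injective.  The dimension [s] of the
    space of the u-coordinates is written as [2 + s], to split off that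
    projection. *)
Definition nil_normal s : 'M[F]_(2 + s + (2 + s) + (2 + s)) :=
  nil_block (block_mx rot2 0 0 0) 0.

(** The block equations under which an [upper_block] matrix conjugates one
    [nil_block] matrix into another. *)
Lemma nil_block_intertwine s (K L J N P1 P2 P3 Y Z : 'M[F]_s) :
  P1 *m K = J *m P2 -> P2 *m K = J *m P3 ->
  P1 *m L - Y *m K = J *m Z + N *m P3 ->
  upper_block P1 P2 P3 Y Z *m nil_block K L =
  nil_block J N *m upper_block P1 P2 P3 Y Z.
Proof.
move=> e1 e2 e3; rewrite /upper_block /nil_block.
rewrite mulmx_block [RHS]mulmx_block !(mulmx0, mul0mx, addr0, add0r).
rewrite mulmx_block [X in _ = block_mx X _ _ _]mulmx_block.
rewrite [block_mx P1 _ _ _ *m _]mul_block_col [block_mx 0 J _ _ *m _]mul_block_col.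
rewrite mul_col_mx !(mulmx0, mul0mx, addr0, add0r) !mulmxN add_col_mx e1.
by rewrite mulNmx e2 e3 add0r.
Qed.

Lemma nil_block_mxrank s (K : 'M[F]_s) :
  \rank (nil_block K 0) = (\rank K + \rank K)%N.
Proof.
(* Multiplying by [Z] permutes the block columns cyclically, which makes the
   matrix block diagonal. *)
pose Z : 'M[F]_(s + s + s) :=
  block_mx (block_mx 0 0 1%:M 0) (col_mx 1%:M 0) (row_mx 0 1%:M) 0.
have Zu : Z \in unitmx.
  have /mulmx1_unit[]// : Z *m Z^T = 1%:M.
  rewrite /Z !tr_block_mx tr_row_mx tr_col_mx !trmx1 !trmx0.
  rewrite mulmx_block !mul0mx !mulmx0 !addr0 mulmx_block.
  rewrite mul_col_row mul_row_block mul_block_col mul_row_col.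
  rewrite !(mulmx0, mul0mx, addr0, add0r, mul1mx) add_block_mx !(addr0, add0r).
  by rewrite row_mx0 col_mx0 -!scalar_mx_block.
rewrite -(mxrankMfree _ (B := Z)) ?row_free_unit //.
have -> : nil_block K 0 *m Z = block_mx (block_mx K 0 0 (- K)) 0 0 0.
  rewrite /nil_block /Z mulmx_block !mulmx0 !mul0mx !addr0 mulmx_block.
  rewrite mul_block_col mul_col_row !(mulmx0, mul0mx, addr0, add0r, mulmx1).
  by rewrite add_block_mx !(addr0, add0r) col_mx0.
by rewrite !rank_diag_block_mx mxrank0 mxrank_opp addn0.
Qed.

Lemma nil_normal_mxrank s : \rank (nil_normal s) = 4%N.
Proof.
suff rJ : \rank (block_mx rot2 0 0 0 : 'M[F]_(2 + s)) = 2%N.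
  by rewrite nil_block_mxrank rJ.
rewrite rank_diag_block_mx mxrank0 addn0.
exact: mxrank_unit rot2_unit.
Qed.

(** The rows of [A] are completed into a basis of the whole space by a basis [C]
    of their orthogonal complement; in this basis [K] is [rot2] extended by 0.
    The block above the diagonal ones has the form [Y1 *m K + K *m Y2], hence
    can be conjugated away. *)
Lemma nil_block_similar s (A T : 'M[F]_(2, 2 + s)) (r : F) : row_free A ->
  nil_block (A^T *m rot2 *m A)
    (r *: (A^T *m rot2 *m A) - T^T *m rot2 *m A - A^T *m rot2 *m T)
  ~_{in unitmx} nil_normal s.
Proof.
move=> fA; have [C fC CA] := orthogonal_complement fA.
set K := A^T *m rot2 *m A; set G := A *m A^T.
have Gu : G \in unitmx by apply: row_free_gram.
pose Q : 'M[F]_(2 + s) := col_mx A C.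
have QQ : Q *m Q^T = block_mx G 0 0 (C *m C^T).
  rewrite tr_col_mx mul_col_row CA; congr block_mx.
  by rewrite -[LHS]trmxK trmx_mul trmxK CA trmx0.
have Qu : Q \in unitmx.
  have : Q *m Q^T \in unitmx.
    rewrite QQ unitmxE unitfE det_ublock mulf_neq0 // -unitfE -unitmxE //.
    exact: row_free_gram.
  by rewrite unitmx_mul => /andP[].
pose J : 'M[F]_(2 + s) := block_mx rot2 0 0 0.
have KE : K = Q^T *m J *m Q.
  rewrite tr_col_mx mul_row_block mul_row_col /K.
  by rewrite !(mulmx0, mul0mx, addr0, add0r).
(* [K] occurs twice: [invmx Q^T] and [Q] put its first occurrence in normal form,
   and the correction [D] does it for the second one, because [Q *m Q^T] is
   block diagonal and [rot2] is invertible. *)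
pose D : 'M[F]_(2 + s) := block_mx (- rot2 *m G *m rot2) 0 0 1%:M.
have Du : D \in unitmx.
  rewrite unitmxE unitfE det_ublock det1 mulr1 -unitfE -unitmxE !unitmx_mul.
  by rewrite Gu rot2_unit !andbT -scaleN1r unitmxZ ?unitrN1 ?rot2_unit.
have QK : Q *m K = J *m (D *m Q).
  rewrite KE !mulmxA QQ /J /D !mulmx_block !(mulmx0, mul0mx, addr0, add0r).
  by rewrite !mulNmx !mulmxN !mulmxA rot2_sqr !mulNmx opprK mul1mx.
(* [invmx G *m A] is the basis of the span of the rows of [A] dual to [A]. *)
pose Y := T^T *m invmx G *m A.
have YA : Y *m A^T = T^T by rewrite /Y -mulmxA mulmxKV.
set L := _ - A^T *m rot2 *m T.
have LE : L = (r%:M - Y) *m K + K *m (- Y^T).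
  rewrite mulmxBl mul_scalar_mx mulmxN /L; congr (_ - _ - _).
    by rewrite /K !mulmxA YA.
  by rewrite /K -[RHS]mulmxA -[A in RHS]trmxK -trmx_mul !trmxK YA trmxK.
have P1K : invmx Q^T *m K = J *m Q by rewrite KE !mulmxA mulVmx ?unitmx_tr // mul1mx.
pose P := upper_block (invmx Q^T) Q (D *m Q) (invmx Q^T *m (r%:M - Y)) (Q *m - Y^T).
have Pu : P \in unitmx.
  by apply: upper_block_unit; rewrite ?unitmx_inv ?unitmx_tr // unitmx_mul Du.
exists P => //; apply/(simmxP Pu).
apply: nil_block_intertwine; rewrite ?P1K ?QK //.
rewrite -/J; clearbody K J; rewrite LE mulmxDr !mulmxA P1K.
by rewrite !mul0mx addr0 addrAC subrr add0r.
Qed.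
End Blocks.

(** * Polynomial functions are smooth *)

Section PolynomialFunctions.
Variables (R : realType) (n : nat).

Lemma is_derive_coord (x v : 'rV[R]_n) (i : 'I_n) :
  is_derive x v (fun y : 'rV[R]_n => y 0 i) (v 0 i).
Proof.
have @f : {linear 'rV[R]_n -> R^o}.
  by exists (fun y : 'rV[R]_n => y 0 i); do 2![eexists]; do ?[constructor];
     rewrite ?mxE// => ? *; rewrite ?mxE//; move=> ?; rewrite !mxE.
have cf : continuous f by exact: coord_continuous.
have df : differentiable f x by exact: linear_differentiable.
apply: DeriveDef; first by apply: (@diff_derivable _ _ _ f).
by rewrite (@deriveE _ _ _ f) // diff_lin.
Qed.

(** Polynomial functions of the coordinates, generated by sums and products. *)
Inductive polynomial_fun : ('rV[R]_n -> R) -> Prop :=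
| PolyConst c : polynomial_fun (cst c)
| PolyCoord i : polynomial_fun (fun x => x 0 i)
| PolyAdd f g : polynomial_fun f -> polynomial_fun g -> polynomial_fun (f + g)
| PolyMul f g : polynomial_fun f -> polynomial_fun g -> polynomial_fun (f * g).

Lemma polynomial_fun_sum (I : Type) (r : seq I) (F : I -> 'rV[R]_n -> R) :
  (forall i, polynomial_fun (F i)) -> polynomial_fun (\sum_(i <- r) F i).
Proof.
move=> pF; elim/big_ind: _ => [|f g pf pg|i _]; last exact: pF.
  exact (PolyConst 0).
exact: PolyAdd.
Qed.

Lemma polynomial_fun_derive f : polynomial_fun f ->
  exists2 f' : 'I_n -> 'rV[R]_n -> R, forall i, polynomial_fun (f' i) &
    forall i x, is_derive x (delta_mx 0 i) f (f' i x).
Proof.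
elim=> [c|j|{}f g pf [f' pf' df] pg [g' pg' dg]|{}f g pf [f' pf' df] pg [g' pg' dg]].
- by exists (fun _ => cst 0) => [i|i x]; [exact (PolyConst 0)|exact: is_derive_cst].
- exists (fun i => cst ((i == j)%:R)) => [i|i x]; first exact (PolyConst _).
  apply: is_derive_eq (is_derive_coord x _ j) _.
  by rewrite mxE eqxx eq_sym.
- exists (fun i => f' i + g' i) => [i|i x]; first exact: PolyAdd.
  exact: is_deriveD.
- exists (fun i => f * g' i + g * f' i) => [i|i x].
    by apply: PolyAdd; apply: PolyMul.
  exact: is_deriveM.
Qed.

Lemma polynomial_fun_continuous f : polynomial_fun f -> continuous f.
Proof.
elim=> [c|j|{}f g _ cf _ cg|{}f g _ cf _ cg] x.
- exact: cst_continuous.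
- exact: coord_continuous.
- exact: (continuousD (cf x) (cg x)).
- exact: (continuousM (cf x) (cg x)).
Qed.

Lemma polynomial_fun_smooth f : polynomial_fun f -> smooth f.
Proof.
move=> pf k; elim: k => [|k IHk] in f pf *; first exact: polynomial_fun_continuous.
have [f' pf' df] := polynomial_fun_derive pf => i.
split=> [x|]; first by have [] := df i x.
have -> : partial i f = f' i; last exact: IHk.
by apply/funext => x; have [] := df i x.
Qed.

Lemma partial_linear (c : 'cV[R]_n) i x :
  partial i (fun y : 'rV[R]_n => (y *m c) 0 0) x = c i 0.
Proof.
rewrite /partial.
have -> : (fun y : 'rV[R]_n => (y *m c) 0 0) =
    \sum_j (c j 0 \*: (fun y : 'rV[R]_n => y 0 j)).
  apply/funext => y; rewrite mxE fct_sumE; apply: eq_bigr => j _ /=.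
  by rewrite mulrC.
have D : is_derive x (delta_mx 0 i)
   (\sum_j (c j 0 \*: (fun y : 'rV[R]_n => y 0 j)))
   (\sum_j c j 0 *: (delta_mx 0 i : 'rV[R]_n) 0 j).
  by apply: is_derive_sum => j; apply: is_deriveZ; apply: is_derive_coord.
rewrite (@derive_val _ _ _ _ _ _ _ D) (bigD1 i) //= big1 ?addr0 ?mxE ?eqxx.
  by rewrite [LHS]mulr1.
by move=> j /negPf ji; rewrite mxE ji [LHS]mulr0.
Qed.

End PolynomialFunctions.

(** * The metric *)

Lemma mulmx_row_inj (R : pzRingType) m n (A B : 'M[R]_(m, n)) :
  (forall x : 'rV_m, x *m A = x *m B) -> A = B.
Proof. by move=> AB; apply/row_matrixP => i; rewrite !rowE. Qed.

Section Metric.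
Variables (R : realType) (s : nat).
Local Notation n := (s + s + s)%N.

(** The row vector with components u, t and v. *)
Definition row3 (u t v : 'rV[R]_s) : 'rV[R]_n := row_mx (row_mx u t) v.

(** The u-, t- and v-components of each row of a matrix of row vectors. *)
Definition pr_u m (A : 'M[R]_(m, n)) : 'M[R]_(m, s) := lsubmx (lsubmx A).
Definition pr_t m (A : 'M[R]_(m, n)) : 'M[R]_(m, s) := rsubmx (lsubmx A).
Definition pr_v m (A : 'M[R]_(m, n)) : 'M[R]_(m, s) := rsubmx A.

Lemma row3K (x : 'rV[R]_n) : x = row3 (pr_u x) (pr_t x) (pr_v x).
Proof. by rewrite /row3 !hsubmxK. Qed.

(** The common value of g(d/du_i, d/du_i). *)
Definition phi (x : 'rV[R]_n) : R := - 2 * \sum_(k < s) pr_u x 0 k * pr_t x 0 k.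

(** The metric is [phi x *: Nmx + Hmx], and [phi x] is minus the quadratic form
    of matrix [Pmx]; thus the differential of [phi] at [x] is [- 2 *: (x *m Pmx)]. *)
Definition Nmx : 'M[R]_n := block_mx (block_mx 1%:M 0 0 0) 0 0 0.
Definition Hmx : 'M[R]_n :=
  block_mx (block_mx 0 0 0 (- 1)%:M) (col_mx 1%:M 0) (row_mx 1%:M 0) 0.
Definition Pmx : 'M[R]_n := block_mx (block_mx 0 1%:M 1%:M 0) 0 0 0.

Lemma g3sE x : g3s x = phi x *: Nmx + Hmx.
Proof.
rewrite /g3s /Nmx /Hmx !scale_block_mx !scaler0 !add_block_mx !add0r !addr0.
by rewrite scalemx1.
Qed.

Lemma mul_row3_Nmx u t v : row3 u t v *m Nmx = row3 u 0 0.
Proof.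
rewrite /row3 mul_row_block mul_row_block.
by rewrite !(mulmx0, mulmx1, addr0).
Qed.

Lemma mul_row3_Hmx u t v : row3 u t v *m Hmx = row3 v (- t) u.
Proof.
rewrite /row3 mul_row_block mul_row_block mul_row_col mul_mx_row.
rewrite !(mulmx0, mulmx1, addr0, add0r) add_row_mx !(addr0, add0r).
by rewrite raddfN /= mulmxN mulmx1.
Qed.

Lemma mul_row3_Pmx u t v : row3 u t v *m Pmx = row3 t u 0.
Proof.
rewrite /row3 mul_row_block mul_row_block.
by rewrite !(mulmx0, mulmx1, addr0, add0r).
Qed.

Lemma row3_dot u t v u' t' v' :
  row3 u t v *m (row3 u' t' v')^T = u *m u'^T + t *m t'^T + v *m v'^T.
Proof. by rewrite /row3 !tr_row_mx !mul_row_col. Qed.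

(** Identities between products of these constant matrices are checked on row
    vectors. *)
Definition row3_mulE := (mul_row3_Nmx, mul_row3_Hmx, mul_row3_Pmx).

Lemma Nmx_sym : Nmx^T = Nmx.
Proof. by rewrite /Nmx !tr_block_mx !trmx0 trmx1. Qed.
Lemma Hmx_sym : Hmx^T = Hmx.
Proof. by rewrite /Hmx !tr_block_mx tr_col_mx tr_row_mx !trmx0 trmx1 tr_scalar_mx. Qed.
Lemma Pmx_sym : Pmx^T = Pmx.
Proof. by rewrite /Pmx !tr_block_mx !trmx0 trmx1. Qed.

Lemma Hmx_sqr : Hmx *m Hmx = 1%:M.
Proof.
apply: mulmx_row_inj => x; rewrite mulmxA mulmx1 (row3K x) !row3_mulE opprK.
by [].
Qed.

Lemma row3_0 : row3 0 0 0 = 0. Proof. by rewrite /row3 !row_mx0. Qed.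

Lemma NHN0 : Nmx *m Hmx *m Nmx = 0.
Proof.
apply: mulmx_row_inj => x; rewrite !mulmxA mulmx0 (row3K x) !row3_mulE.
exact: row3_0.
Qed.

Lemma PHN0 : Pmx *m Hmx *m Nmx = 0.
Proof.
apply: mulmx_row_inj => x; rewrite !mulmxA mulmx0 (row3K x) !row3_mulE.
exact: row3_0.
Qed.

Lemma g3s_sym (x : 'rV[R]_n) : (g3s x)^T = g3s x.
Proof. by rewrite g3sE linearD linearZ /= Nmx_sym Hmx_sym. Qed.

Lemma g3s_inv (x : 'rV[R]_n) : invmx (g3s x) = Hmx - phi x *: (Hmx *m Nmx *m Hmx).
Proof.
suff e : (Hmx - phi x *: (Hmx *m Nmx *m Hmx)) *m g3s x = 1%:M.
  have [_ gu] := mulmx1_unit e.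
  by rewrite -[RHS](mulmxK gu) e mul1mx.
rewrite g3sE mulmxDr !mulmxBl -!scalemxAr -!scalemxAl -!(mulmxA (Hmx *m Nmx)).
rewrite Hmx_sqr mulmx1 -!mulmxA [Nmx *m (Hmx *m Nmx)]mulmxA NHN0 mulmx0 !scaler0.
by rewrite subr0 addrC subrK.
Qed.

Lemma phi_polyE : phi =
  cst (- 2) * \sum_(k < s) (fun y : 'rV[R]_n => y 0 (lshift s (lshift s k))) *
                           (fun y : 'rV[R]_n => y 0 (lshift s (rshift s k))).
Proof.
apply/funext => y; rewrite /phi mulrfctE fct_sumE; congr (_ * _).
by apply: eq_bigr => k _; rewrite !mxE.
Qed.

Lemma phi_polynomial : polynomial_fun phi.
Proof.
rewrite phi_polyE; apply: PolyMul; first exact (PolyConst _ _).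
by apply: polynomial_fun_sum => k; apply: PolyMul; apply: PolyCoord.
Qed.

Lemma partial_phi i x : partial i phi x = - 2 * (x *m Pmx) 0 i.
Proof.
rewrite /partial phi_polyE; set e := delta_mx 0 i.
have D := is_deriveM (is_derive_cst (- 2 : R) x e)
  (is_derive_sum (fun k : 'I_s => is_deriveM
     (is_derive_coord x e (lshift s (lshift s k)))
     (is_derive_coord x e (lshift s (rshift s k))))).
rewrite (@derive_val _ _ _ _ _ _ _ D) scaler0 addr0; congr (_ * _).
have -> : (x *m Pmx) 0 i = (x *m Pmx *m e^T) 0 0.
  by rewrite /e trmx_delta -colE [RHS]mxE.
rewrite [in RHS](row3K x) [in RHS](row3K e) row3_mulE row3_dot mul0mx addr0.
rewrite !mxE -big_split; apply: eq_bigr => k _ /=.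
by rewrite !mxE addrC.
Qed.

Lemma partial_g3s i j l (x : 'rV[R]_n) :
  partial i (fun y => g3s y j l) x = - 2 * (x *m Pmx) 0 i * Nmx j l.
Proof.
have -> : (fun y => g3s y j l) = phi * cst (Nmx j l) + cst (Hmx j l).
  by apply/funext => y; rewrite g3sE !mxE.
have dphi : derivable phi x (delta_mx 0 i).
  by have [f' _ /(_ i x)[]] := polynomial_fun_derive phi_polynomial.
rewrite -partial_phi /partial; set e := delta_mx 0 i in dphi *.
have D := is_deriveD (is_deriveM (derivableP dphi) (is_derive_cst (Nmx j l) x e))
  (is_derive_cst (Hmx j l) x e).
by rewrite (@derive_val _ _ _ _ _ _ _ D) scaler0 add0r addr0 mulrC.
Qed.

Lemma smooth_g3s i j : smooth (fun x => @g3s R s x i j).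
Proof.
apply: polynomial_fun_smooth.
have -> : (fun y => g3s y i j) = phi * cst (Nmx i j) + cst (Hmx i j).
  by apply/funext => y; rewrite g3sE !mxE.
apply: PolyAdd (PolyMul _ _) _; try exact (PolyConst _ _).
exact: phi_polynomial.
Qed.
End Metric.

(** * The curvature *)

Section Curvature.
Variables (R : realType) (s : nat).
Local Notation n := (s + s + s)%N.
Local Notation N := (Nmx R s).
Local Notation H := (Hmx R s).
Local Notation P := (Pmx R s).
Local Notation Q := (Pmx R s *m Hmx R s).
Local Notation N' := (Nmx R s *m Hmx R s).

(** In this section, [N'] and [Q] are the matrices [N] and [P] with their second
    index raised; the [phi] part of the inverse metric does not contribute, by
    [NHN0] and [PHN0]. *)
Lemma christoffelE k i j (x : 'rV[R]_n) : christoffel (@g3s R s) k i j x =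
  - (x *m P) 0 i * N' j k - (x *m P) 0 j * N' i k + N i j * (x *m Q) 0 k.
Proof.
have invS l : invmx (g3s x) k l = invmx (g3s x) l k.
  by rewrite -{1}(g3s_sym x) -trmx_inv mxE.
have NI : N *m invmx (g3s x) = N'.
  by rewrite g3s_inv mulmxBr -scalemxAr !mulmxA NHN0 mul0mx scaler0 subr0.
have PI : P *m invmx (g3s x) = Q.
  by rewrite g3s_inv mulmxBr -scalemxAr !mulmxA PHN0 mul0mx scaler0 subr0.
have NE m : N' m k = \sum_l invmx (g3s x) k l * N m l.
  by rewrite -NI mxE; apply: eq_bigr => l _; rewrite invS mulrC.
have QE : (x *m Q) 0 k = \sum_l invmx (g3s x) k l * (x *m P) 0 l.
  by rewrite -PI mulmxA mxE; apply: eq_bigr => l _; rewrite invS mulrC.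
rewrite /christoffel !NE QE !mulr_sumr -sumrN -!big_split /=.
by apply: eq_bigr => l _; rewrite !partial_g3s; field.
Qed.

(** The matrix of the covariant derivative of the coordinate fields in the
    direction of the j-th coordinate. *)
Definition connection_mx (x : 'rV[R]_n) j : 'M[R]_n :=
  (row j N)^T *m (x *m Q) - (x *m P) 0 j *: N' - (x *m P)^T *m row j N'.

Lemma connection_mxE x j k m :
  connection_mx x j k m = christoffel (@g3s R s) m j k x.
Proof.
rewrite christoffelE /connection_mx !mxE !big_ord1 !mxE; ring.
Qed.

(** All the products of two terms of the connection matrices vanish but the
    one of the first term by the last. *)
Lemma connection_mx_mul x i j : connection_mx x j *m connection_mx x i =
  - (x *m Q *m (x *m P)^T) 0 0 *: ((row j N)^T *m row i N').
Proof.
have NN : N' *m N' = 0 by rewrite !mulmxA NHN0 mul0mx.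
have QN : Q *m N' = 0 by rewrite !mulmxA -[P *m H *m N]mulmxA mulmxA PHN0 mul0mx.
have NP : N' *m (x *m P)^T = 0.
  have -> : N' *m (x *m P)^T = (x *m (P *m H *m N))^T.
    by rewrite !trmx_mul Nmx_sym Hmx_sym Pmx_sym !mulmxA.
  by rewrite PHN0 mulmx0 trmx0.
have QNt a : x *m Q *m (row a N)^T = 0.
  rewrite rowE trmx_mul Nmx_sym.
  have -> u : x *m Q *m (N *m u) = x *m (P *m H *m N) *m u by rewrite !mulmxA.
  by rewrite PHN0 mulmx0 mul0mx.
have NNt a : N' *m (row a N)^T = 0.
  by rewrite rowE trmx_mul Nmx_sym mulmxA NHN0 mul0mx.
rewrite /connection_mx.
set c := (x *m P) 0 _; set d := (x *m P) 0 _.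
have rM a p (X : 'M[R]_(n, p)) : N' *m X = 0 -> row a N' *m X = 0.
  by move=> NX; rewrite rowE -mulmxA NX mulmx0.
have qN : x *m Q *m N' = 0 by rewrite -mulmxA QN mulmx0.
have midA (u : 'cV[R]_n) (v : 'rV_n) (w : 'cV_n) (z : 'rV_n) :
  u *m v *m (w *m z) = u *m (v *m w) *m z by rewrite !mulmxA.
rewrite !mulmxBl !mulmxBr -!scalemxAl -!scalemxAr NN !midA.
rewrite !(mulmxA N') NP !NNt QNt !rM //.
rewrite -(mulmxA _ (x *m Q) N') -(mulmxA _ (row j N') N') qN rM //.
rewrite !(mulmx0, mul0mx, scaler0, subr0).
move: (x *m Q *m _) => q; rewrite {1}[q]mx11_scalar mul_mx_scalar -scalemxAl.
by rewrite scaleNr sub0r.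
Qed.

(** A bilinear expression in [a] and [b] whose antisymmetrization is R(a, b). *)
Definition curvature_form (x a b : 'rV[R]_n) : 'M[R]_n :=
  (b *m N)^T *m (a *m Q) + (b *m P)^T *m (a *m N')
  - (x *m Q *m (x *m P)^T) 0 0 *: ((b *m N)^T *m (a *m N')).

Lemma partial_christoffel k i j l (x : 'rV[R]_n) :
  partial l (christoffel (@g3s R s) k i j) x =
  - P l i * N' j k - P l j * N' i k + N i j * Q l k.
Proof.
have -> : christoffel (@g3s R s) k i j = fun y =>
   (y *m (- N' j k *: col i P - N' i k *: col j P + N i j *: col k Q)) 0 0.
  apply/funext => y; rewrite christoffelE.
  have e (A B C : 'cV[R]_n) (f g h : R) : (y *m (f *: A - g *: B + h *: C)) 0 0
      = f * (y *m A) 0 0 - g * (y *m B) 0 0 + h * (y *m C) 0 0.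
    by rewrite mulmxDr mulmxBr -!scalemxAr !mxE.
  rewrite e !colE !(mulmxA y) -!colE; rewrite [(col i _) 0 0]mxE.
  rewrite [(col j _) 0 0]mxE [(col k _) 0 0]mxE; ring.
rewrite partial_linear !mxE; ring.
Qed.

Lemma riemannE i j k l (x : 'rV[R]_n) : riemann (@g3s R s) i j k l x =
  (curvature_form x (delta_mx 0 i) (delta_mx 0 j)
   - curvature_form x (delta_mx 0 j) (delta_mx 0 i)) k l.
Proof.
rewrite /riemann !partial_christoffel.
have -> : \sum_m (christoffel (@g3s R s) m j k x * christoffel (@g3s R s) l i m x
     - christoffel (@g3s R s) m i k x * christoffel (@g3s R s) l j m x)
  = (connection_mx x j *m connection_mx x i) k l
    - (connection_mx x i *m connection_mx x j) k l.
  rewrite sumrB; congr (_ - _); rewrite mxE; apply: eq_bigr => m _;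
    by rewrite !connection_mxE.
rewrite !connection_mx_mul /curvature_form -!rowE.
have Ns a b : N a b = N b a by rewrite -{1}Nmx_sym mxE.
have Ps a b : P a b = P b a by rewrite -{1}Pmx_sym mxE.
set c := (_ *m _) 0 0; clearbody c.
move: Ns Ps; move: (N') (Q) (N) (P) => A B C D Cs Ds.
rewrite !mxE !big_ord1 !mxE (Cs j) (Cs i) (Ds j k) (Ds i k) (Ds i j); ring.
Qed.

(** Both sides are bilinear in [a] and [b], and agree on coordinate vectors. *)
Lemma curvature_opE (x a b : 'rV[R]_n) : curvature_op (@g3s R s) x a b =
  curvature_form x a b - curvature_form x b a.
Proof.
have formE c d : curvature_form x c d =
    \sum_i \sum_j (c 0 i * d 0 j) *:
      curvature_form x (delta_mx 0 i) (delta_mx 0 j).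
  have outer A B : (d *m A)^T *m (c *m B) = \sum_i \sum_j (c 0 i * d 0 j) *:
      ((delta_mx 0 j *m A : 'rV[R]_n)^T *m (delta_mx 0 i *m B : 'rV[R]_n)).
    rewrite [RHS]exchange_big {1}[d]row_sum_delta {1}[c]row_sum_delta /=.
    rewrite !mulmx_suml [(\sum_(i < n) _)^T]linear_sum mulmx_suml; apply: eq_bigr => j _.
    rewrite mulmx_sumr; apply: eq_bigr => i _ /=.
    by rewrite -!scalemxAl [(_ *: _)^T]linearZ /= -scalemxAl -scalemxAr scalerA mulrC.
  rewrite /curvature_form !outer scaler_sumr -big_split -sumrB /=.
  apply: eq_bigr => i _; rewrite scaler_sumr -big_split -sumrB /=.
  by apply: eq_bigr => j _; rewrite scalerBr scalerDr !scalerA [c 0 i * _ * _]mulrC.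
apply/matrixP => k l; rewrite [curvature_form x a b]formE.
rewrite [curvature_form x b a]formE [X in _ - X]exchange_big -sumrB mxE summxE.
apply: eq_bigr => i _; rewrite -sumrB summxE; apply: eq_bigr => j _ /=.
by rewrite riemannE [b 0 j * _]mulrC -scalerBr [RHS]mxE.
Qed.

(** Minus the square of the Euclidean norm of the u-coordinates of the point. *)
Definition kappa (x : 'rV[R]_n) : R := - (pr_u x *m (pr_u x)^T) 0 0.

Lemma curvature_op_nil (x a b : 'rV[R]_n) : curvature_op (@g3s R s) x a b =
  nil_block (wedge (pr_u a) (pr_u b))
    (kappa x *: wedge (pr_u a) (pr_u b) - wedge (pr_t a) (pr_u b)
     - wedge (pr_u a) (pr_t b)).
Proof.
have kE : (x *m Q *m (x *m P)^T) 0 0 = kappa x.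
  rewrite {1 2}(row3K x) !mulmxA !row3_mulE row3_dot !mul0mx trmx0 mulmx0.
  by rewrite add0r addr0 mulNmx mxE.
have NE c : c *m N = row3 (pr_u c) 0 0 by rewrite {1}(row3K c) row3_mulE.
have PE c : c *m P = row3 (pr_t c) (pr_u c) 0 by rewrite {1}(row3K c) row3_mulE.
have NE' c : c *m N' = row3 0 0 (pr_u c).
  by rewrite {1}(row3K c) mulmxA !row3_mulE oppr0.
have QE c : c *m Q = row3 0 (- pr_u c) (pr_t c).
  by rewrite {1}(row3K c) mulmxA !row3_mulE.
rewrite curvature_opE /curvature_form kE !NE !PE !NE' !QE.
move: (pr_u a) (pr_t a) (pr_u b) (pr_t b) (kappa x) => al at_ be bt k.
have row3_outer (u t v u' t' v' : 'rV[R]_s) : (row3 u t v)^T *m row3 u' t' v' =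
    block_mx (block_mx (u^T *m u') (u^T *m t') (t^T *m u') (t^T *m t'))
      (col_mx (u^T *m v') (t^T *m v')) (row_mx (v^T *m u') (v^T *m t')) (v^T *m v').
  by rewrite /row3 !tr_row_mx mul_col_row mul_col_row mul_col_mx mul_mx_row.
rewrite !row3_outer !trmx0 !(mulmx0, mul0mx) !scale_block_mx !scale_col_mx.
rewrite !scale_row_mx !scaler0 !opp_block_mx !opp_col_mx !opp_row_mx.
rewrite !add_block_mx !add_col_mx !add_row_mx.
rewrite !(oppr0, addr0, add0r, block_mx0, row_mx0, col_mx0).
rewrite !opp_block_mx opp_col_mx !add_block_mx add_col_mx.
rewrite !(oppr0, addr0, mulmxN, opprK) /nil_block /wedge.
congr (block_mx (block_mx _ _ _ _) (col_mx _ _) _ _); rewrite ?opprB //.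
  by rewrite addrC.
move: (be^T *m at_) (bt^T *m al) (be^T *m al) (al^T *m bt) (at_^T *m be) => A B.
move: (al^T *m be) => C D E F; apply/matrixP => i j; rewrite !mxE; ring.
Qed.
End Curvature.

(** * Orthonormal frames *)

Section FrameMatrix.
Variables (R : realType) (n : nat).

(** The matrix whose rows are the vectors of a frame. *)
Definition frame_mx k (e : k.-tuple 'rV[R]_n) : 'M[R]_(k, n) :=
  \matrix_i tnth e i.

Lemma basis_frame_mx k (W : {vspace 'rV[R]_n}) (e : k.-tuple 'rV[R]_n) :
  basis_of W e ->
  (forall y, y *m frame_mx e \in W) /\ row_free (frame_mx e).
Proof.
have E y : y *m frame_mx e = \sum_i y 0 i *: e`_i.
  rewrite mulmx_sum_row; apply: eq_bigr => i _.
  by rewrite rowK (tnth_nth 0).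
move=> be; split=> [y|].
  rewrite E; apply: memv_suml => i _; apply: memvZ.
  by apply: (basis_mem be); rewrite mem_nth ?size_tuple.
apply: inj_row_free => y; rewrite E => y0.
apply/rowP => i; rewrite mxE.
by have /freeP := basis_free be; apply.
Qed.

(** A matrix whose rows are orthonormal up to a common sign is the frame matrix
    of an orthonormal basis of a definite subspace, timelike if [b] holds and
    spacelike otherwise. *)
Lemma definite_frame g (x : 'rV[R]_n) k (E : 'M[R]_(k, n)) (b : bool) :
  E *m g x *m E^T = ((-1) ^+ b)%:M ->
  exists W (e : k.-tuple 'rV[R]_n),
    [/\ frame_mx e = E, orthonormal_basis g x W e, \dim W = k,
        forall a, a \in W -> exists y, a = y *m E &
        if b then timelike g x W else spacelike g x W].
Proof.
move=> EgE; pose e : k.-tuple 'rV[R]_n := [tuple row i E | i < k].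
have eE : frame_mx e = E by apply/row_matrixP => i; rewrite rowK tnth_mktuple.
have spanE a : a \in <<e>>%VS -> exists y, a = y *m E.
  move=> ae; exists (\row_i coord e i a); rewrite {1}(coord_span ae) mulmx_sum_row.
  by apply: eq_bigr => i _; rewrite mxE -tnth_nth tnth_mktuple.
have dotE y z : gdot g x (y *m E) (z *m E) = (-1) ^+ b * (y *m z^T) 0 0.
  rewrite /gdot trmx_mul !mulmxA -(mulmxA y) -(mulmxA y) EgE.
  by rewrite mul_mx_scalar -scalemxAl mxE.
have fE : free e.
  apply/freeP => c c0 i.
  have c0' : (\row_i c i) *m E = 0.
    rewrite -{}[RHS]c0 mulmx_sum_row; apply: eq_bigr => j _.
    by rewrite mxE -tnth_nth tnth_mktuple.
  have : gdot g x ((\row_i c i) *m E) ((\row_i c i) *m E) = 0.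
    by rewrite c0' /gdot !mul0mx mxE.
  rewrite dotE => /eqP; rewrite mulf_eq0 signr_eq0 /= => /eqP /dotmx_eq0.
  by move/rowP/(_ i); rewrite !mxE.
have be : basis_of <<e>> e.
  by rewrite basisEfree fE subvv size_tuple (eqP fE) size_tuple /=.
exists <<e>>%VS, e; split=> //.
- split=> // i j; rewrite !tnth_mktuple !rowE dotE normrM normr_sign mul1r.
  by rewrite trmx_delta -rowE !mxE eqxx andbT normr_nat.
- by rewrite (eqP fE) size_tuple.
- have : forall a, a \in <<e>>%VS -> a != 0 -> 0 < (-1) ^+ b * gdot g x a a.
    move=> a /spanE[y ->] a0; rewrite dotE mulrA -expr2 sqrr_sign mul1r.
    rewrite lt_neqAle dotmx_ge0 andbT eq_sym.
    by apply: contraNneq a0 => /dotmx_eq0 ->; rewrite mul0mx.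
  case: (b) => pos a ae a0; have := pos a ae a0.
    by rewrite mulN1r oppr_gt0.
  by rewrite mul1r.
Qed.
End FrameMatrix.

Section Frames.
Variables (R : realType) (s : nat).
Local Notation n := (s + s + s)%N.
Local Notation g := (@g3s R s).
Implicit Types (x : 'rV[R]_n) (W : {vspace 'rV[R]_n}).

Lemma gram_g3s k m x (E : 'M[R]_(k, n)) (F : 'M[R]_(m, n)) : E *m g x *m F^T =
  phi x *: (pr_u E *m (pr_u F)^T) + pr_u E *m (pr_v F)^T
  + pr_v E *m (pr_u F)^T - pr_t E *m (pr_t F)^T.
Proof.
have rE p (A : 'M[R]_(p, n)) : A = row_mx (row_mx (pr_u A) (pr_t A)) (pr_v A).
  by rewrite !hsubmxK.
rewrite {1}(rE _ E) {1}(rE _ F) /g3s -/(pr_u x) -/(pr_t x) -/(phi x).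
move: (phi x) => c.
rewrite mul_row_block [row_mx (pr_u E) _ *m block_mx _ _ _ _]mul_row_block.
rewrite mul_row_col mul_mx_row.
rewrite !(mulmx0, mulmx1, addr0, add0r) add_row_mx !tr_row_mx !mul_row_col.
rewrite addr0 raddfN /= mulmxN mulmx1 mulmxDl mulNmx mul_mx_scalar -scalemxAl.
rewrite -!addrA; congr (_ + _); rewrite [RHS]addrCA.
by rewrite [X in _ + X = _]addrC.
Qed.

Lemma gdot_g3s x a : gdot g x a a =
  phi x * (pr_u a *m (pr_u a)^T) 0 0 + 2 * (pr_u a *m (pr_v a)^T) 0 0
  - (pr_t a *m (pr_t a)^T) 0 0.
Proof.
have vu : pr_v a *m (pr_u a)^T = pr_u a *m (pr_v a)^T.
  rewrite -[LHS]trmxK trmx_mul trmxK.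
  by rewrite [pr_u a *m _]mx11_scalar tr_scalar_mx.
rewrite /gdot gram_g3s vu.
move: (pr_u a *m _) (pr_u a *m _) (pr_t a *m _) => A B C.
by rewrite !mxE; ring.
Qed.

Lemma pr_uM k m (y : 'M[R]_(k, m)) (E : 'M[R]_(m, n)) : pr_u (y *m E) = y *m pr_u E.
Proof. by rewrite /pr_u !mulmx_lsub. Qed.

Lemma pr_tM k m (y : 'M[R]_(k, m)) (E : 'M[R]_(m, n)) : pr_t (y *m E) = y *m pr_t E.
Proof. by rewrite /pr_t mulmx_rsub mulmx_lsub. Qed.

(** A vector with zero u-component has nonpositive square. *)
Lemma spacelike_row_free x W k (e : k.-tuple 'rV[R]_n) :
  spacelike g x W -> basis_of W e -> row_free (pr_u (frame_mx e)).
Proof.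
move=> sW /basis_frame_mx[yW fE]; apply: inj_row_free => y.
rewrite -pr_uM => u0; apply: (row_free_inj fE); rewrite mul0mx.
apply/eqP; apply: contraT => a0; have := sW _ (yW y) a0.
rewrite gdot_g3s u0 !mul0mx mxE !mulr0 addr0 sub0r oppr_gt0.
by rewrite ltNge dotmx_ge0.
Qed.

(** A vector with zero u- and t-components is null, so the u- and t-components
    of a timelike frame are jointly independent. *)
Lemma timelike_mxrank x W k (e : k.-tuple 'rV[R]_n) :
  timelike g x W -> basis_of W e -> (k <= \rank (pr_u (frame_mx e)) + s)%N.
Proof.
move=> tW /basis_frame_mx[yW fE]; set E := frame_mx e in yW fE *.
have : row_free (row_mx (pr_u E) (pr_t E)).
  apply: inj_row_free => y; rewrite mul_mx_row -pr_uM -pr_tM -row_mx0.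
  case/eq_row_mx => u0 t0; apply: (row_free_inj fE); rewrite mul0mx.
  apply/eqP; apply: contraT => a0; have := tW _ (yW y) a0.
  by rewrite gdot_g3s u0 t0 !mul0mx mxE !mulr0 addr0 subr0 ltxx.
move/eqP; rewrite -mxrank_tr tr_row_mx -addsmxE => {1}<-.
apply: leq_trans (mxrank_adds_leqif _ _) _.
by rewrite !mxrank_tr leq_add2l rank_leq_col.
Qed.

(** The vectors d/du_i - (1 + phi) / 2 d/dv_i, for [i < p], followed by the
    d/dt_j, for [j < q]; they are orthonormal and timelike. *)
Definition timelike_frame_mx x p q : 'M[R]_(p + q, n) :=
  row_mx (row_mx (col_mx (pid_mx p) 0) (col_mx 0 (pid_mx q)))
         ((- (1 + phi x) / 2) *: col_mx (pid_mx p) 0).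

(** The vectors d/du_i + (1 - phi) / 2 d/dv_i; they are orthonormal and
    spacelike, and orthogonal to the frames above. *)
Definition spacelike_frame_mx x : 'M[R]_(s, n) :=
  row_mx (row_mx 1%:M 0) ((1 - phi x) / 2)%:M.

Lemma gram_timelike_frame x p q : (p <= s)%N -> (q <= s)%N ->
  timelike_frame_mx x p q *m g x *m (timelike_frame_mx x p q)^T = ((-1) ^+ true)%:M.
Proof.
move=> ps qs; rewrite gram_g3s /pr_u /pr_t /pr_v !(row_mxKl, row_mxKr).
rewrite [(_ *: _)^T]linearZ /= -scalemxAl -scalemxAr !tr_col_mx !mul_col_row.
rewrite !trmx0 !tr_pid_mx !(mulmx0, mul0mx) !pid_mx_id // !pid_mx_1.
rewrite expr1 -!scalerDl (scalar_mx_block p q) !scale_block_mx opp_block_mx.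
rewrite !scaler0 add_block_mx !oppr0 !addr0 add0r scalemx1.
by rewrite -!raddfN /=; congr (block_mx _%:M _ _ _); field.
Qed.

Lemma gram_spacelike_frame x :
  spacelike_frame_mx x *m g x *m (spacelike_frame_mx x)^T = ((-1) ^+ false)%:M.
Proof.
rewrite gram_g3s /pr_u /pr_t /pr_v !(row_mxKl, row_mxKr).
rewrite trmx0 trmx1 tr_scalar_mx !(mulmx0, mulmx1, mul1mx) subr0 expr0.
by rewrite scalemx1 -!raddfD /=; congr (_%:M); field.
Qed.

Lemma gram_frames x :
  timelike_frame_mx x s s *m g x *m (spacelike_frame_mx x)^T = 0.
Proof.
rewrite gram_g3s /pr_u /pr_t /pr_v !(row_mxKl, row_mxKr).
rewrite trmx0 trmx1 tr_scalar_mx !mulmx0 !mulmx1 subr0 mul_mx_scalar -!scalerDl.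
by rewrite [X in X *: _](_ : _ = 0) ?scale0r //; field.
Qed.

Lemma timelike_frame x k p q : (p <= s)%N -> (q <= s)%N -> k = (p + q)%N ->
  exists W (e : k.-tuple 'rV[R]_n),
    [/\ timelike g x W, orthonormal_basis g x W e &
        \rank (pr_u (frame_mx e)) = p].
Proof.
move=> ps qs ->.
have [W [e [eE oe _ _ tW]]] := definite_frame (gram_timelike_frame x ps qs).
exists W, e; split=> //.
by rewrite eE /pr_u !row_mxKl -addsmxE addsmx0 rank_pid_mx // leq_addr.
Qed.

(** * The curvature operators of a frame *)

Lemma stanilov_opE x k (e : k.-tuple 'rV[R]_n) :
  let A := pr_u (frame_mx e) in
  stanilov_op g x e =
  corner (2 *: (((\tr (A^T *m A))%:M - A^T *m A) *m (A^T *m A))).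
Proof.
move=> A; rewrite /stanilov_op.
under eq_bigr => i _ do under eq_bigr => j _ do
  rewrite curvature_op_nil nil_block_sqr.
have rA i : pr_u (tnth e i) = row i A by rewrite /A rowE -pr_uM -rowE rowK.
under eq_bigr => i _ do rewrite corner_sum.
rewrite corner_sum; congr corner.
transitivity (- \sum_i \sum_j wedge (row i A) (row j A) *m wedge (row i A) (row j A)).
  rewrite -sumrN; apply: eq_bigr => i _; rewrite -sumrN; apply: eq_bigr => j _.
  by rewrite !rA.
by rewrite sum_wedge_sqr scaleNr opprK.
Qed.

Lemma stanilov_rank_leq x k (e : k.-tuple 'rV[R]_n) :
  (\rank (stanilov_op g x e) <= \rank (pr_u (frame_mx e)))%N.
Proof.
rewrite stanilov_opE corner_mxrank mxrank_scale_nz ?pnatr_eq0 //.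
apply: leq_trans (mxrankM_maxr _ _) (mxrankM_maxr _ _).
Qed.

Lemma stanilov_rank x k (e : k.-tuple 'rV[R]_n) :
  (1 < \rank (pr_u (frame_mx e)))%N ->
  \rank (stanilov_op g x e) = \rank (pr_u (frame_mx e)).
Proof.
move=> rA; rewrite stanilov_opE corner_mxrank mxrank_scale_nz ?pnatr_eq0 //.
rewrite eqmxMfull ?row_full_unit ?unitmx_trace_gram //.
by rewrite -{2}[pr_u _]trmxK mxrank_gram mxrank_tr.
Qed.

Lemma stanilov_similar x k (e e' : k.-tuple 'rV[R]_n) :
  \rank (stanilov_op g x e) = \rank (stanilov_op g x e') ->
  same_jordan_form (stanilov_op g x e) (stanilov_op g x e').
Proof.
by rewrite !stanilov_opE !corner_mxrank; apply: corner_similar.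
Qed.

Lemma skew_curvature_opE x (e : 2.-tuple 'rV[R]_n) :
  let A := pr_u (frame_mx e) in let T := pr_t (frame_mx e) in
  skew_curvature_op g x e =
  nil_block (A^T *m rot2 R *m A) (kappa x *: (A^T *m rot2 R *m A)
    - T^T *m rot2 R *m A - A^T *m rot2 R *m T).
Proof.
move=> A T; rewrite /skew_curvature_op curvature_op_nil.
have rA i : pr_u (tnth e i) = row i A by rewrite /A rowE -pr_uM -rowE rowK.
have rT i : pr_t (tnth e i) = row i T by rewrite /T rowE -pr_tM -rowE rowK.
have wE (B C : 'M[R]_(2, s)) :
    B^T *m rot2 R *m C = (row 0 B)^T *m row 1 C - (row 1 B)^T *m row 0 C.
  apply/matrixP => i j; rewrite !mxE !big_ord_recl !big_ord0 !mxE.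
  rewrite !big_ord_recl !big_ord0 !mxE.
  have -> : lift ord0 ord0 = 1 :> 'I_2 by apply: val_inj.
  by rewrite /=; ring.
rewrite !wE !rA !rT /wedge; congr nil_block.
move: (_^T *m _) (_^T *m _) (_^T *m _) (_^T *m _) (_^T *m _) (_^T *m _).
move=> B C D E F G; apply/matrixP => i j; rewrite !mxE; ring.
Qed.
End Frames.

Theorem theorem1p7 (R : realType) (s : nat) (hs : (2 <= s)%N) :
  [/\ pseudo_riemannian (2 * s) s (@g3s R s),
      spacelike_rank_jordan_ivanov_petrova 4 (@g3s R s),
      ~ jordan_ivanov_petrova (@timelike R (s + s + s)) (@g3s R s),
      forall k : nat, (2 <= k <= s)%N ->
        jordan_stanilov (@spacelike R (s + s + s)) k (@g3s R s) &
      forall k : nat, (2 <= k <= 2 * s)%N ->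
        (jordan_stanilov (@timelike R (s + s + s)) k (@g3s R s)
         <-> k = (2 * s)%N)].
Proof.
have normal m (x : 'rV[R]_(2 + m + (2 + m) + (2 + m))) (e : 2.-tuple _) :
    row_free (pr_u (frame_mx e)) ->
    skew_curvature_op (@g3s R (2 + m)) x e ~_{in unitmx} nil_normal R m.
  by move=> fA; rewrite skew_curvature_opE; apply: nil_block_similar.
split.
- split=> [|i j|x|x]; [lia|exact: smooth_g3s|exact: g3s_sym|].
  have [U [e [_ _ dU sU tU]]] :=
    definite_frame (gram_timelike_frame x (leqnn s) (leqnn s)).
  have [V [f [_ _ dV sV tV]]] := definite_frame (gram_spacelike_frame x).
  have UV0 : (U :&: V)%VS = 0%VS.
    apply/eqP; rewrite -subv0; apply/subvP => a /memv_capP[aU aV].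
    rewrite memv0; apply: contraT => a0.
    by have := lt_trans (tU _ aU a0) (tV _ aV a0); rewrite ltxx.
  exists U, V; split=> //.
  + apply/eqP; rewrite eqEdim subvf dimvf /dim /= dimv_disjoint_sum // dU dV.
    by rewrite mul1n.
  + by split=> //; rewrite dU; lia.
  + move=> a b /sU[y ->] /sV[z ->]; rewrite /gdot trmx_mul !mulmxA.
    by rewrite -(mulmxA y) -(mulmxA y) gram_frames mulmx0 mul0mx mxE.
- case: s hs normal => [|[|m]] // hs normal.
  split=> [x W W' e e' sW sW' [be _] [be' _]|x W e sW [be _]].
    exact: similar_common (normal m x e (spacelike_row_free sW be))
                         (normal m x e' (spacelike_row_free sW' be')).
  rewrite -(nil_normal_mxrank R m); apply/similar_rank/normal.
  exact: spacelike_row_free sW be.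
(* At the origin, the curvature operator has rank 4 on the timelike plane spanned
   by d/du_i - 1/2 d/dv_i for two values of i, and is zero on the one spanned by
   two of the d/dt_j. *)
- move=> ip.
  have [W [e [tW oe rA]]] := @timelike_frame R s 0 2 2 0 hs (leq0n s) erefl.
  have [W' [e' [tW' oe' rA']]] := @timelike_frame R s 0 2 0 2 (leq0n s) hs erefl.
  have /similar_rank := ip 0 W W' e e' tW tW' oe oe'.
  have -> : \rank (skew_curvature_op (@g3s R s) 0 e') = 0%N.
    move/eqP: rA'; rewrite mxrank_eq0 => /eqP A0.
    rewrite skew_curvature_opE A0 !(mulmx0, trmx0, mul0mx, scaler0, subr0).
    by rewrite /nil_block oppr0 col_mx0 !block_mx0 mxrank0.
  case: s hs normal e {tW oe ip tW' oe' rA' W W' e'} rA => [|[|m]] // hs normal e rA.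
  have /eqP fA := rA.
  by rewrite (similar_rank (normal m 0 e fA)) nil_normal_mxrank.
- move=> k /andP[k2 ks] x W W' e e' sW sW' [be _] [be' _].
  have /eqP rA := spacelike_row_free sW be.
  have /eqP rA' := spacelike_row_free sW' be'.
  by apply: stanilov_similar; rewrite !stanilov_rank ?rA ?rA'.
move=> k /andP[k2 ks]; split=> [st|->]; last first.
  move=> x W W' e e' tW tW' [be _] [be' _].
  have rk (Z : {vspace 'rV[R]_(s + s + s)}) (f : (2 * s).-tuple _) :
      timelike (@g3s R s) x Z -> basis_of Z f -> \rank (pr_u (frame_mx f)) = s.
    move=> tZ bf; have := timelike_mxrank tZ bf.
    have := rank_leq_col (pr_u (frame_mx f)); lia.
  have rA := rk _ _ tW be; have rA' := rk _ _ tW' be'.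
  by apply: stanilov_similar; rewrite !stanilov_rank ?rA ?rA'.
(* Two timelike [k]-planes at the origin, of u-ranks [p] and [q]. *)
pose p := minn k s; pose q := (k - p)%N.
have kE : k = (p + q)%N by rewrite /q /p; lia.
have ps : (p <= s)%N by rewrite /p; lia.
have qs : (q <= s)%N by rewrite /q /p; lia.
have p2 : (1 < p)%N by rewrite /p; lia.
suff : (p <= q)%N by rewrite /q /p; lia.
clearbody p q; subst k.
have [W [e [tW oe rA]]] := @timelike_frame R s 0 _ _ _ ps qs (erefl (p + q)%N).
have [W' [e' [tW' oe' rA']]] := @timelike_frame R s 0 _ _ _ qs ps (addnC p q).
have /similar_rank := st 0 W W' e e' tW tW' oe oe'.
rewrite stanilov_rank ?rA // => ->.
by apply: leq_trans (stanilov_rank_leq _ _) _; rewrite rA'.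
Qed.
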